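(* Let $\mathcal{M}^I_m$ be a timelike first kind meridian surface of hyperbolic type in $\mathbb{R}^4_1$, parametrized by $z(u,v)=f(u)\,l(v)+g(u)\,e_1$, $u\in I$, $v\in J$. Then $\mathcal{M}^I_m$ is flat (its Gauss curvature vanishes identically) if and only if the meridian curve $m:u\mapsto(f(u),g(u))$ is given by $$f(u)=a\,u+b,\qquad g(u)=\pm\sqrt{1-a^2}\;u+c,$$ where $a,b,c$ are constants.
   Context: $\mathbb{R}^4_1$ is the Minkowski 4-space with metric $\langle\cdot,\cdot\rangle = dx_1^2+dx_2^2+dx_3^2-dx_4^2$ and standard orthonormal frame $e_1,e_2,e_3,e_4$ ($e_4$ timelike). $\mathbb{S}^2_1(1)=\{V\in\mathrm{span}\{e_2,e_3,e_4\}:\langle V,V\rangle=1\}$. A first kind meridian surface of hyperbolic type is the surface $z(u,v)=f(u)l(v)+g(u)e_1$, where $I,J\subset\mathbb{R}$ are intervals, $f,g:I\to\mathbb{R}$ are smooth with $f>0$, and $l:J\to\mathbb{S}^2_1(1)$ is a smooth timelike curve with $\langle l',l'\rangle=-1$ (prime $=d/dv$). The meridian curve is parametrized by arc length: $\dot f^2+\dot g^2=1$ (dot $=d/du$). The induced metric is $du^2-f(u)^2dv^2$; the Gauss curvature is that of this Lorentzian metric, $K=\dfrac{\langle\sigma(X,X),\sigma(Y,Y)\rangle-\langle\sigma(X,Y),\sigma(X,Y)\rangle}{\langle X,X\rangle\langle Y,Y\rangle-\langle X,Y\rangle^2}$, with $\sigma$ the second fundamental form. *)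

(* Defs.v *)
From HB Require Import structures.
From mathcomp Require Import all_boot all_order all_algebra.
From mathcomp Require Import all_classical all_reals all_analysis.
From mathcomp Require Import ring.

Set Implicit Arguments.
Unset Strict Implicit.
Unset Printing Implicit Defensive.

Import Order.TTheory GRing.Theory Num.Theory.
Import numFieldNormedType.Exports.

Local Open Scope classical_set_scope.
Local Open Scope ring_scope.

(* Smoothness on an arbitrary subset [A] of the line: derivatives of every
   order exist in a neighbourhood of each point of [A].  Functions are total,
   so a map defined on [A] only is represented by a local smooth extension,
   which matters only at endpoints of [A] belonging to [A]. *)
Definition smooth_on (R : realType) (V : normedModType R) (A : set R)
    (h : R -> V) : Prop :=
  forall (n : nat) (x : R), A x -> \forall y \near x, derivable (derive1n n h) y 1.

Definition nondegenerate_interval (R : realType) (I : set R) : Prop :=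
  is_interval I /\ I° !=set0.

Section Minkowski.
Context {R : realType}.
Implicit Types x y w X Y : 'rV[R]_4.

(* Coordinates are numbered from 0, so x_1, ..., x_4 and e_1, ..., e_4 are
   indexed by 0, ..., 3; the timelike direction is the last one. *)
Definition mink x y : R :=
  x 0 0 * y 0 0 + x 0 1 * y 0 1 + x 0 2 * y 0 2 - x 0 3 * y 0 3.

Definition e1 : 'rV[R]_4 := delta_mx 0 0.
Definition e2 : 'rV[R]_4 := delta_mx 0 1.
Definition e3 : 'rV[R]_4 := delta_mx 0 2.
Definition e4 : 'rV[R]_4 := delta_mx 0 3.

Definition de_sitter2 : set 'rV[R]_4 :=
  [set V | V \in <<[:: e2; e3; e4]>>%VS /\ mink V V = 1].

Definition gram X Y : R := mink X X * mink Y Y - mink X Y ^+ 2.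

(* Component of [w] in the splitting of the ambient space into span(X, Y) and
   its orthogonal complement, for [gram X Y != 0]: the coefficients of the
   tangential part solve the 2 x 2 linear system with the Gram matrix of
   (X, Y), see [normal_part_spec]. *)
Definition tangent_part X Y w : 'rV[R]_4 :=
  ((mink w X * mink Y Y - mink w Y * mink X Y) / gram X Y) *: X
  + ((mink w Y * mink X X - mink w X * mink X Y) / gram X Y) *: Y.

Definition normal_part X Y w : 'rV[R]_4 := w - tangent_part X Y w.

Lemma normal_part_spec X Y w : gram X Y != 0 ->
  mink (normal_part X Y w) X = 0 /\ mink (normal_part X Y w) Y = 0.
Proof.
move=> D0.
have lin p q Z : mink (w - (p *: X + q *: Y)) Z =
    mink w Z - p * mink X Z - q * mink Y Z.
  by rewrite /mink !mxE; ring.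
have sym : mink Y X = mink X Y by rewrite /mink; ring.
rewrite /normal_part /tangent_part !lin sym.
by move: D0; rewrite /gram => D0; split; field.
Qed.

(* A parametrized surface is a map [z : R -> R -> 'rV[R]_4], (u, v) |-> z u v. *)
Implicit Types z : R -> R -> 'rV[R]_4.

Definition d_u z (u v : R) : 'rV[R]_4 := derive1 (z ^~ v) u.
Definition d_v z (u v : R) : 'rV[R]_4 := derive1 (z u) v.

Definition normal_to z (u v : R) : 'rV[R]_4 -> 'rV[R]_4 :=
  normal_part (d_u z u v) (d_v z u v).

(* Values of the second fundamental form on the coordinate fields z_u, z_v:
   normal parts of the ambient derivatives of those fields. *)
Definition sigma_uu z u v := normal_to z u v (d_u (d_u z) u v).
Definition sigma_uv z u v := normal_to z u v (d_u (d_v z) u v).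
Definition sigma_vv z u v := normal_to z u v (d_v (d_v z) u v).

(* Determinant E G - F^2 of the induced metric. *)
Definition metric_det z u v : R := gram (d_u z u v) (d_v z u v).

(* The quotient defining K does not depend on the basis (X, Y) of the tangent
   plane; it is evaluated at X = z_u, Y = z_v. *)
Definition gauss_curvature z u v : R :=
  (mink (sigma_uu z u v) (sigma_vv z u v)
   - mink (sigma_uv z u v) (sigma_uv z u v)) / metric_det z u v.

(* The induced metric is Lorentzian at every point. *)
Definition timelike_surface (I J : set R) z : Prop :=
  forall u v, I u -> J v -> metric_det z u v < 0.

Definition flat_surface (I J : set R) z : Prop :=
  forall u v, I u -> J v -> gauss_curvature z u v = 0.

Definition meridian_surface (f g : R -> R) (l : R -> 'rV[R]_4) :
    R -> R -> 'rV[R]_4 :=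
  fun u v => f u *: l v + g u *: e1.

Record first_kind_hyperbolic (I J : set R) (f g : R -> R)
    (l : R -> 'rV[R]_4) : Prop := FirstKindHyperbolic {
  fkh_I : nondegenerate_interval I;
  fkh_J : nondegenerate_interval J;
  fkh_f_smooth : smooth_on I f;
  fkh_g_smooth : smooth_on I g;
  fkh_f_gt0 : forall u, I u -> 0 < f u;
  fkh_arclength : forall u, I u -> derive1 f u ^+ 2 + derive1 g u ^+ 2 = 1;
  fkh_l_smooth : smooth_on J l;
  fkh_l_range : forall v, J v -> de_sitter2 (l v);
  fkh_l_timelike : forall v, J v -> mink (derive1 l v) (derive1 l v) = -1
}.

End Minkowski.

(* Main.v *)
Require Import Defs.
From mathcomp Require Import all_boot all_order all_algebra.
From mathcomp Require Import all_classical all_reals all_analysis.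
From mathcomp Require Import ring lra.

Set Implicit Arguments.
Unset Strict Implicit.
Unset Printing Implicit Defensive.

Import Order.TTheory GRing.Theory Num.Theory.
Import numFieldNormedType.Exports.

Local Open Scope classical_set_scope.
Local Open Scope ring_scope.

(** The whole content is the identity [K = - f'' / f].  Since [l] takes values
in the unit de Sitter sphere of span(e_2, e_3, e_4), differentiating
[<l, l> = 1] and [<l, e_1> = 0] gives [<l, l'> = 0],
[<l, l''> = - <l', l'> = 1] and [l'], [l''] orthogonal to [e_1].  Hence
[z_u = f' l + g' e_1] and [z_v = f l'] are orthogonal of squares [1] and
[- f ^ 2].  The vector [z_uu = f'' l + g'' e_1] is already normal, because
[f' f'' + g' g'' = 0] by arc length; [z_uv = f' l'] is tangent; so the numerator
of [K] is [<z_uu, z_vv> = f f'' <l, l''> = f f''], while the determinant of the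
metric is [- f ^ 2] ([gauss_curvature_meridian]).

Flatness therefore means [f'' = 0] on [I], that is, [f' = a] is constant.  Arc
length then says that [g' ^ 2] is the constant [1 - a ^ 2]; differentiating,
[g' g'' = 0], so [g'] itself is constant, with one sign on all of [I]
([cst_derive1_of_sqr]).

The intervals may contain their endpoints, where a function is only known on
one side while its derivative is two-sided.  The lemma [derive_eq_on] bridges
this: two differentiable functions that agree on a nondegenerate interval have
the same derivative at each of its points, endpoints included. *)

(** * Derivatives of smooth and of matrix-valued functions *)

Lemma derive1_val (R : realType) (V : normedModType R) (h : R -> V) (x : R) dh :
  is_derive x 1 h dh -> derive1 h x = dh.
Proof. by move=> hx; rewrite derive1E derive_val. Qed.

Lemma near_eq_derive1 (R : realType) (V : normedModType R) (h k : R -> V)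
    (x : R) :
  (\forall y \near x, h y = k y) -> derive1 h x = derive1 k x.
Proof. by move=> hk; rewrite !derive1E; exact: near_eq_derive. Qed.

Lemma smooth_on_near (R : realType) (V : normedModType R) (A : set R)
    (h : R -> V) n (x : R) : smooth_on A h -> A x ->
  \forall y \near x, is_derive (y : R) 1 (derive1n n h) (derive1n n.+1 h y).
Proof.
move=> sm Ax; apply: filterS (sm n x Ax) => y dy.
by apply: DeriveDef => //; rewrite derive1nS derive1E.
Qed.

Lemma smooth_on_at (R : realType) (V : normedModType R) (A : set R)
    (h : R -> V) n (x : R) : smooth_on A h -> A x ->
  is_derive x 1 (derive1n n h) (derive1n n.+1 h x).
Proof. by move=> sm Ax; exact: (nbhs_singleton (smooth_on_near n sm Ax)). Qed.

Lemma is_derive_mx (R : realType) (m n : nat) (M : R -> 'M[R]_(m, n))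
    (t : R) dM :
  is_derive t 1 M dM <->
  forall i j, is_derive t 1 (fun x => M x i j) (dM i j).
Proof.
split=> [[Mt <-] i j|Mij].
  by apply: DeriveDef; [exact: (derivable_mxP M t 1).1|rewrite derive_mx// mxE].
have Mt : derivable M t 1 by apply/derivable_mxP => i j; case: (Mij i j).
apply: DeriveDef => //; rewrite derive_mx//.
by apply/matrixP => i j; rewrite mxE derive_val.
Qed.

Lemma is_derive_lincomb (R : realType) (m n : nat) (A B : 'M[R]_(m, n))
    (p q : R -> R) (t : R) dp dq :
  is_derive t 1 p dp -> is_derive t 1 q dq ->
  is_derive t 1 (fun x => p x *: A + q x *: B) (dp *: A + dq *: B).
Proof.
move=> hp hq; apply/is_derive_mx => i j.
have -> : (fun x => (p x *: A + q x *: B) i j) = A i j \*: p + B i j \*: q.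
  by apply/funext => x; rewrite !mxE !fctE /= mulrC [X in _ + X]mulrC.
by apply: is_derive_eq; rewrite !mxE; congr (_ + _); exact: mulrC.
Qed.

(** * Calculus on a nondegenerate interval *)

Section interval_calculus.
Context {R : realType} (I : set R).
Hypothesis I_nondeg : nondegenerate_interval I.

Lemma nondegenerate_interval_neq x : exists2 y, I y & y != x.
Proof.
case: I_nondeg => _ [y Iy]; have [yx|] := eqVneq y x; last first.
  by exists y => //; exact: interior_subset.
move: Iy; rewrite yx => /nbhs_ballP[e /= e0 eI].
exists (x + e / 2); last by rewrite -subr_eq0; lra.
by apply: eI; rewrite /ball /= opprD addNKr normrN gtr0_norm; lra.
Qed.

(** Fix another point [y] of the interval.  For small [s > 0] the point
[x + s (y - x)] is in the interval, so the difference quotients of [h - k] in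
the direction [y - x] vanish; as [y - x != 0], this directional derivative
determines the derivative. *)
Lemma derive_eq_on (h k : R -> R) (x : R) dh dk : I x ->
  (forall y, I y -> h y = k y) ->
  is_derive x 1 h dh -> is_derive x 1 k dk -> dh = dk.
Proof.
move=> Ix hk dhx dkx.
have [y Iy yx] := nondegenerate_interval_neq x.
pose d := h - k.
have dx : is_derive x 1 d (dh - dk) by exact: is_deriveB.
have d0 z : I z -> d z = 0 by move=> Iz; rewrite /d !fctE hk// subrr.
have dfd : differentiable d x by apply/derivable1_diffP; case: dx.
have dyx : derivable d x (y - x) by exact: diff_derivable.
(* The limit over the punctured neighbourhood can be taken from the right. *)
have Dyx : 'D_(y - x) d x = 0.
  rewrite /derive cvg_at_rightE//; apply: lim_near_cst => //.
  near=> s; rewrite /= [X in _ *: X](_ : _ = 0) ?scaler0//.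
  rewrite (d0 x Ix) d0 ?subrr//.
  have s0 : 0 < s by near: s; exact: nbhs_right_gt.
  have s1 : s < 1 by near: s; exact: nbhs_right_lt.
  have [I_itv _] := I_nondeg.
  have [xy|xy] := leP x y.
    apply: (I_itv _ _ Ix Iy); rewrite /GRing.scale /=; apply/andP; split; nra.
  apply: (I_itv _ _ Iy Ix); rewrite /GRing.scale /=; apply/andP; split; nra.
have : (y - x) * (dh - dk) = 0.
  rewrite -(@derive_val _ _ _ _ _ _ _ dx) deriveE//.
  by rewrite -[_ * _]/(_ *: _) -linearZ [_ *: 1]mulr1 -deriveE.
move/eqP; rewrite mulf_eq0 !subr_eq0 (negbTE yx) /=; exact/eqP.
Unshelve. all: by end_near. Qed.

Lemma derive0_on_cst (h dh : R -> R) :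
  (forall x, I x -> is_derive x 1 h (dh x)) -> (forall x, I x -> dh x = 0) ->
  forall x y, I x -> I y -> h x = h y.
Proof.
move=> hd dh0.
suff H x y : I x -> I y -> x <= y -> h x = h y.
  move=> x y Ix Iy; case: (leP x y) => [|/ltW] xy; first exact: H.
  by symmetry; exact: H.
move=> Ix Iy xy.
have sub z : z \in `[x, y] -> I z.
  by rewrite in_itv /=; case: I_nondeg => I_itv _; exact: I_itv.
have [||c cxy] := @MVT_segment R h dh x y xy.
- by move=> z /subset_itv_oo_cc zxy; exact/hd/sub.
- apply: derivable_within_continuous => z /sub /hd [] //.
rewrite dh0; last exact: sub.
by rewrite mul0r => /eqP; rewrite subr_eq0 => /eqP ->.
Qed.

Lemma affine_on (h dh : R -> R) a :
  (forall x, I x -> is_derive x 1 h (dh x)) -> (forall x, I x -> dh x = a) ->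
  exists b, forall x, I x -> h x = a * x + b.
Proof.
move=> hd dha; have [x0 Ix0 _] := nondegenerate_interval_neq 0.
exists (h x0 - a * x0) => x Ix.
pose k := h - a \*: id.
have kd y : I y -> is_derive y 1 k (dh y - a).
  move=> Iy; have := hd y Iy => ?; apply: is_derive_eq.
  by congr (_ - _); exact: mulr1.
have : k x = k x0.
  by apply: (derive0_on_cst kd) => // y Iy; rewrite dha// subrr.
rewrite /k !fctE /= /GRing.scale /= => E; lra.
Qed.

End interval_calculus.

(** * The Minkowski product *)

Section minkowski_algebra.
Context {R : realType}.
Implicit Types x y w X Y : 'rV[R]_4.

Lemma minkC x y : mink x y = mink y x.
Proof. by rewrite /mink; ring. Qed.

Lemma minkDl x y w : mink (x + y) w = mink x w + mink y w.
Proof. by rewrite /mink !mxE; ring. Qed.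

Lemma minkZl c x w : mink (c *: x) w = c * mink x w.
Proof. by rewrite /mink !mxE; ring. Qed.

Lemma minkDr x y w : mink w (x + y) = mink w x + mink w y.
Proof. by rewrite minkC minkDl !(minkC w). Qed.

Lemma minkZr c x w : mink w (c *: x) = c * mink w x.
Proof. by rewrite minkC minkZl (minkC w). Qed.

(** For an orthogonal pair, [tangent_part] is the sum of the two projections
onto the lines of [X] and [Y], so Pythagoras' formula applies. *)
Lemma mink_normal_part X Y w w' : mink X Y = 0 ->
  mink X X != 0 -> mink Y Y != 0 ->
  mink (normal_part X Y w) (normal_part X Y w') =
  mink w w' - mink w X * mink w' X / mink X X - mink w Y * mink w' Y / mink Y Y.
Proof.
move=> XY XX YY; rewrite /normal_part /tangent_part /gram XY.
rewrite -!(scaleN1r (_ + _)) !(minkDl, minkDr, minkZl, minkZr) (minkC Y X) XY.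
rewrite (minkC X w') (minkC Y w').
by field; rewrite YY XX.
Qed.

Lemma is_derive_mink (p q : R -> 'rV[R]_4) (t : R) dp dq :
  is_derive t 1 p dp -> is_derive t 1 q dq ->
  is_derive t 1 (fun s => mink (p s) (q s)) (mink dp (q t) + mink (p t) dq).
Proof.
move=> /is_derive_mx hp /is_derive_mx hq.
pose P i s := p s 0 i; pose Q i s := q s 0 i.
have hP i : is_derive t 1 (P i) (dp 0 i) by exact: hp.
have hQ i : is_derive t 1 (Q i) (dq 0 i) by exact: hq.
have -> : (fun s => mink (p s) (q s)) =
    P 0 * Q 0 + P 1 * Q 1 + P 2 * Q 2 - P 3 * Q 3 by [].
apply: is_derive_eq; rewrite /mink /P /Q /GRing.scale /=; ring.
Qed.

Lemma mink_e1 x : mink x e1 = x 0 0.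
Proof. by rewrite /mink /e1 !mxE /=; ring. Qed.

Lemma de_sitter2_orth_e1 x : de_sitter2 x -> mink x e1 = 0.
Proof.
case=> + _; rewrite mink_e1 !span_cons span_nil addv0.
case/memv_addP => a /vlineP[k ->] [b + ->].
case/memv_addP => c /vlineP[k' ->] [d /vlineP[k'' ->] ->].
by rewrite !mxE /=; ring.
Qed.

End minkowski_algebra.

(** * Curves in the de Sitter sphere *)

Section de_sitter_curve.
Context {R : realType} (J : set R) (l : R -> 'rV[R]_4).
Hypotheses (J_nondeg : nondegenerate_interval J) (l_smooth : smooth_on J l).
Hypothesis l_range : forall v, J v -> de_sitter2 (l v).

Let l1 v (Jv : J v) : is_derive v 1 l (derive1 l v) :=
  smooth_on_at 0 l_smooth Jv.
Let l2 v (Jv : J v) : is_derive v 1 (derive1 l) (derive1n 2 l v) :=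
  smooth_on_at 1 l_smooth Jv.

(** These four identities come from differentiating, along [J], a product of [l]
or [l'] that is constant on [J]: [<l, e_1> = 0], [<l', e_1> = 0], [<l, l> = 1],
[<l, l'> = 0] in turn. *)
Lemma velocity_orth_e1 v : J v -> mink (derive1 l v) e1 = 0.
Proof.
move=> Jv; have de := is_derive_mink (l1 Jv) (is_derive_cst e1 v 1).
have := derive_eq_on J_nondeg Jv _ de (is_derive_cst 0 v 1).
rewrite -(scale0r e1) minkZr mul0r addr0; apply => w Jw.
exact/de_sitter2_orth_e1/l_range.
Qed.

Lemma acceleration_orth_e1 v : J v -> mink (derive1n 2 l v) e1 = 0.
Proof.
move=> Jv; have de := is_derive_mink (l2 Jv) (is_derive_cst e1 v 1).
have := derive_eq_on J_nondeg Jv _ de (is_derive_cst 0 v 1).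
by rewrite -(scale0r e1) minkZr mul0r addr0; apply; exact: velocity_orth_e1.
Qed.

Lemma velocity_orth v : J v -> mink (l v) (derive1 l v) = 0.
Proof.
move=> Jv; have de := is_derive_mink (l1 Jv) (l1 Jv).
have := derive_eq_on J_nondeg Jv _ de (is_derive_cst (1 : R) v 1).
rewrite (minkC (derive1 l v)) => H.
have : mink (l v) (derive1 l v) + mink (l v) (derive1 l v) = 0.
  by apply: H => w /l_range[].
by move=> ?; lra.
Qed.

Lemma mink_acceleration v : J v ->
  mink (l v) (derive1n 2 l v) = - mink (derive1 l v) (derive1 l v).
Proof.
move=> Jv; have de := is_derive_mink (l1 Jv) (l2 Jv).
have /eqP := derive_eq_on J_nondeg Jv velocity_orth de (is_derive_cst 0 v 1).
by rewrite addrC addr_eq0 => /eqP.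
Qed.

End de_sitter_curve.

(** * Partial derivatives of a meridian surface *)

Section meridian_surface_derivatives.
Context {R : realType}.
Variables (I J : set R) (f g : R -> R) (l : R -> 'rV[R]_4).
Hypotheses (f_smooth : smooth_on I f) (g_smooth : smooth_on I g).
Hypothesis l_smooth : smooth_on J l.
Local Notation z := (meridian_surface f g l).

Let near_f n u (Iu : I u) := smooth_on_near n f_smooth Iu.
Let near_g n u (Iu : I u) := smooth_on_near n g_smooth Iu.

(** The formulas for the first derivatives are needed on a full neighbourhood,
because an endpoint of the interval is reached from both sides when they are
differentiated again. *)
Lemma d_u_meridian_near u v : I u ->
  \forall t \near u, d_u z t v = derive1 f t *: l v + derive1 g t *: e1.
Proof.
move=> Iu; near=> t; apply: derive1_val; apply: is_derive_lincomb.
- by near: t; exact: near_f 0%N u Iu.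
- by near: t; exact: near_g 0%N u Iu.
Unshelve. all: by end_near. Qed.

Lemma d_u_meridian u v : I u ->
  d_u z u v = derive1 f u *: l v + derive1 g u *: e1.
Proof. by move=> Iu; exact: (nbhs_singleton (d_u_meridian_near v Iu)). Qed.

Lemma d_uu_meridian u v : I u ->
  d_u (d_u z) u v = derive1n 2 f u *: l v + derive1n 2 g u *: e1.
Proof.
move=> Iu; rewrite {1}/d_u (near_eq_derive1 (d_u_meridian_near v Iu)).
apply: derive1_val; apply: is_derive_lincomb.
- exact: (smooth_on_at 1 f_smooth Iu).
- exact: (smooth_on_at 1 g_smooth Iu).
Qed.

Lemma d_v_meridian_near u v : J v ->
  \forall t \near v, d_v z u t = f u *: derive1 l t.
Proof.
move=> Jv; near=> t; apply: derive1_val.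
have lt : is_derive t 1 l (derive1 l t).
  by near: t; exact: (smooth_on_near 0 l_smooth Jv).
rewrite -[X in is_derive _ _ _ X]addr0.
exact: (is_deriveD (is_deriveZ (f u) lt) (is_derive_cst _ _ _)).
Unshelve. all: by end_near. Qed.

Lemma d_v_meridian u v : J v -> d_v z u v = f u *: derive1 l v.
Proof. by move=> Jv; exact: (nbhs_singleton (d_v_meridian_near u Jv)). Qed.

Lemma d_vv_meridian u v : J v -> d_v (d_v z) u v = f u *: derive1n 2 l v.
Proof.
move=> Jv; rewrite {1}/d_v (near_eq_derive1 (d_v_meridian_near u Jv)).
apply: derive1_val; apply: is_deriveZ.
exact: (smooth_on_at 1 l_smooth Jv).
Qed.

Lemma d_uv_meridian u v : I u -> J v ->
  d_u (d_v z) u v = derive1 f u *: derive1 l v.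
Proof.
move=> Iu Jv; rewrite {1}/d_u.
under [X in derive1 X]funext do rewrite d_v_meridian//.
apply: derive1_val.
have fu := smooth_on_at 0 f_smooth Iu.
have := is_derive_lincomb (derive1 l v) 0 fu fu.
by rewrite scaler0 addr0; under eq_fun do rewrite scaler0 addr0.
Qed.

End meridian_surface_derivatives.

(** * Gauss curvature *)

(** Half the derivative of the arc length identity: the acceleration of the
meridian is orthogonal to its velocity. *)
Lemma arclength_orth (R : realType) (I : set R) (f g : R -> R) u :
  nondegenerate_interval I -> smooth_on I f -> smooth_on I g ->
  (forall u, I u -> derive1 f u ^+ 2 + derive1 g u ^+ 2 = 1) -> I u ->
  derive1 f u * derive1n 2 f u + derive1 g u * derive1n 2 g u = 0.
Proof.
move=> I_nondeg f_smooth g_smooth arc Iu.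
have f2 := smooth_on_at 1 f_smooth Iu; have g2 := smooth_on_at 1 g_smooth Iu.
have dE := is_deriveD (is_deriveX 2 f2) (is_deriveX 2 g2).
have := derive_eq_on I_nondeg Iu _ dE (is_derive_cst (1 : R) u 1).
move=> /(_ arc); rewrite /GRing.scale /= !expr1 -!mulrA -mulrDr => /eqP.
by rewrite mulf_eq0 pnatr_eq0 /= => /eqP.
Qed.

(** The algebraic core, at one point: [L], [L1], [L2] stand for [l], [l'],
[l''], and [r], [(p, q)], [(p2, q2)] for [f], [(f', g')], [(f'', g'')].  The
hypothesis [p * p2 + q * q2 = 0] makes [z_uu] normal, and the numerator of the
curvature reduces to [<z_uu, z_vv> = p2 * r]. *)
Lemma gauss_quotient_meridian (R : realType) (L L1 L2 : 'rV[R]_4)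
    (r p q p2 q2 : R) (X := p *: L + q *: e1) (Y := r *: L1) :
  r != 0 -> p ^+ 2 + q ^+ 2 = 1 -> p * p2 + q * q2 = 0 ->
  mink L e1 = 0 -> mink L1 e1 = 0 -> mink L2 e1 = 0 ->
  mink L L = 1 -> mink L L1 = 0 -> mink L1 L1 = -1 -> mink L L2 = 1 ->
  (mink (normal_part X Y (p2 *: L + q2 *: e1)) (normal_part X Y (r *: L2))
   - mink (normal_part X Y (p *: L1)) (normal_part X Y (p *: L1))) / gram X Y =
  - p2 / r.
Proof.
move=> r0 pq orth LE L1E L2E LL LL1 L1L1 LL2.
have ee : mink e1 e1 = 1 :> R by rewrite mink_e1 mxE.
(* Products with [e1] on the left, and with [L] on the right, are swapped into
   the order of the hypotheses above. *)
have bilin := (@minkDl R, @minkDr R, @minkZl R, @minkZr R,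
  LE, LL, ee, L1E, L2E, LL1, L1L1, LL2,
  minkC (@e1 R), minkC L1 L, minkC L2 L).
have XX : mink X X = 1 by rewrite -[RHS]pq /X !bilin; ring.
have XY : mink X Y = 0 by rewrite /X /Y !bilin; ring.
have YY : mink Y Y = - r ^+ 2 by rewrite /Y !bilin; ring.
have uuX : mink (p2 *: L + q2 *: e1) X = 0.
  by rewrite -[RHS]orth /X !bilin; ring.
have uuY : mink (p2 *: L + q2 *: e1) Y = 0 by rewrite /Y !bilin; ring.
have uvX : mink (p *: L1) X = 0 by rewrite /X !bilin; ring.
have XX0 : mink X X != 0 by rewrite XX oner_neq0.
have YY0 : mink Y Y != 0 by rewrite YY oppr_eq0 expf_neq0.
rewrite !mink_normal_part// /gram XX XY YY uuX uuY uvX /Y !bilin.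
by field.
Qed.

(** The metric is [du ^ 2 - f ^ 2 dv ^ 2], of curvature [- f'' / f] as for a
surface of revolution. *)
Lemma gauss_curvature_meridian (R : realType) (I J : set R) (f g : R -> R)
    (l : R -> 'rV[R]_4) u v :
  first_kind_hyperbolic I J f g l -> I u -> J v ->
  gauss_curvature (meridian_surface f g l) u v = - derive1n 2 f u / f u.
Proof.
move=> [I_nd J_nd f_sm g_sm f_gt0 arc l_sm l_rng l_tl] Iu Jv.
rewrite /gauss_curvature /metric_det /sigma_uu /sigma_uv /sigma_vv /normal_to.
rewrite (d_uu_meridian l f_sm g_sm)// (d_uv_meridian g f_sm l_sm)//.
rewrite (d_vv_meridian f g l_sm)//.
rewrite (d_u_meridian l f_sm g_sm)// (d_v_meridian f g l_sm)//.
apply: gauss_quotient_meridian.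
- by rewrite gt_eqF ?f_gt0.
- exact: arc.
- exact: (arclength_orth I_nd f_sm g_sm arc Iu).
- exact/de_sitter2_orth_e1/l_rng.
- exact: (velocity_orth_e1 J_nd l_sm l_rng Jv).
- exact: (acceleration_orth_e1 J_nd l_sm l_rng Jv).
- by case: (l_rng v Jv).
- exact: (velocity_orth J_nd l_sm l_rng Jv).
- exact: l_tl.
- by rewrite (mink_acceleration J_nd l_sm)// l_tl// opprK.
Qed.

(** * Flat meridian surfaces *)

(** Differentiation, rather than an intermediate value argument, locks the sign
of [g']: from [g' ^ 2 = k] follows [g' g'' = 0], hence [g'' = 0] wherever [k != 0]. *)
Lemma cst_derive1_of_sqr (R : realType) (I : set R) (g : R -> R) k :
  nondegenerate_interval I -> smooth_on I g ->
  (forall u, I u -> derive1 g u ^+ 2 = k) ->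
  (forall u, I u -> derive1 g u = Num.sqrt k) \/
  (forall u, I u -> derive1 g u = - Num.sqrt k).
Proof.
move=> I_nd g_sm g'2.
have [u0 Iu0 _] := nondegenerate_interval_neq I_nd 0.
have k0 : 0 <= k by rewrite -(g'2 _ Iu0) sqr_ge0.
have cst u : I u -> derive1 g u = derive1 g u0.
  move=> Iu; have [kz|kn0] := eqVneq k 0.
    have g'0 t : I t -> derive1 g t = 0.
      by move=> It; apply/eqP; rewrite -sqrf_eq0 g'2 ?kz.
    by rewrite !g'0.
  apply: (derive0_on_cst I_nd (fun u Iu => smooth_on_at 1 g_sm Iu)) => // t It.
  have dg := smooth_on_at 1 g_sm It.
  have := derive_eq_on I_nd It g'2 (is_deriveX 2 dg) (is_derive_cst k t 1).
  rewrite /GRing.scale /= expr1 => /eqP.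
  rewrite !mulf_eq0 pnatr_eq0 /= => /orP[/eqP g'0|/eqP//].
  by move: kn0; rewrite -(g'2 _ It) g'0 expr0n eqxx.
have : derive1 g u0 ^+ 2 = Num.sqrt k ^+ 2 by rewrite sqr_sqrtr// g'2.
move/eqP; rewrite eqf_sqr => /orP[] /eqP E; [left|right] => u Iu;
  by rewrite cst.
Qed.

Unset Implicit Arguments.

Theorem theorem5p1 (R : realType) (I J : set R) (f g : R -> R)
    (l : R -> 'rV[R]_4)
    (hM : first_kind_hyperbolic I J f g l)
    (ht : timelike_surface I J (meridian_surface f g l)) :
  flat_surface I J (meridian_surface f g l) <->
  exists a b c : R,
    [/\ a ^+ 2 <= 1,
        forall u, I u -> f u = a * u + b &
        (forall u, I u -> g u = Num.sqrt (1 - a ^+ 2) * u + c) \/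
        (forall u, I u -> g u = - Num.sqrt (1 - a ^+ 2) * u + c)].
Proof.
have [I_nd J_nd f_sm g_sm f_gt0 arc _ _ _] := hM.
have f1 u (Iu : I u) := smooth_on_at 0 f_sm Iu.
have g1 u (Iu : I u) := smooth_on_at 0 g_sm Iu.
have f2 u (Iu : I u) := smooth_on_at 1 f_sm Iu.
have [u0 Iu0 _] := nondegenerate_interval_neq I_nd 0.
have [v0 Jv0 _] := nondegenerate_interval_neq J_nd 0.
split=> [flat|[a [b [c [_ fE _]]]] u v Iu Jv].
  have f''0 u : I u -> derive1n 2 f u = 0.
    move=> Iu; have /eqP := flat u v0 Iu Jv0.
    rewrite (gauss_curvature_meridian hM)// mulf_eq0 invr_eq0 oppr_eq0.
    by rewrite (gt_eqF (f_gt0 u Iu)) orbF => /eqP.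
  pose a := derive1 f u0.
  have f'a u : I u -> derive1 f u = a.
    by move=> Iu; exact: (derive0_on_cst I_nd f2 f''0).
  have g'2 u : I u -> derive1 g u ^+ 2 = 1 - a ^+ 2.
    by move=> Iu; rewrite -(arc u Iu) f'a//; ring.
  have [b fE] := affine_on I_nd f1 f'a.
  have a1 : a ^+ 2 <= 1 by rewrite -subr_ge0 -(g'2 _ Iu0) sqr_ge0.
  have [g'E|g'E] := cst_derive1_of_sqr I_nd g_sm g'2;
    have [c gE] := affine_on I_nd g1 g'E; exists a, b, c; split=> //.
  - by left.
  - by right.
have f'a t : I t -> derive1 f t = a.
  move=> It; apply: (derive_eq_on I_nd It fE (f1 t It)).
  have -> : (fun t => a * t + b) = a \*: id + cst b by [].
  by apply: is_derive_eq; rewrite addr0; exact: mulr1.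
have f''0 : derive1n 2 f u = 0.
  exact: (derive_eq_on I_nd Iu f'a (f2 u Iu) (is_derive_cst a u 1)).
by rewrite (gauss_curvature_meridian hM)// f''0 oppr0 mul0r.
Qed.
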